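(* Let $N\ge 2$, let $X^1,\dots,X^N$ be Polish spaces and $X=\prod_{i=1}^N X^i$. For $i=1,\dots,N$ let $\mu^i\in\mathcal P(X^i)$ be a Borel probability measure with compact support, and let $c:X\to\mathbb R\cup\{+\infty\}$ be continuous. If $\gamma\in\Pi(\mu^1,\dots,\mu^N)$ is an infinitely $c$-cyclically monotone (ICM) plan for $c$, then $\gamma$ is optimal for the problem $(P_\infty)$, i.e. $C_\infty[\gamma]\le C_\infty[\beta]$ for every $\beta\in\Pi(\mu^1,\dots,\mu^N)$.
   Context: $\mathcal P(Y)$ denotes the set of Borel probability measures on $Y$. $\Pi(\mu^1,\dots,\mu^N)$ is the set of $\gamma\in\mathcal P(X)$ whose $i$-th marginal (push-forward under the projection $X\to X^i$) is $\mu^i$ for every $i=1,\dots,N$; its elements are called couplings or transport plans. Continuity of $c$ is with respect to the usual topology of $(-\infty,+\infty]$. For $\gamma\in\mathcal P(X)$, $C_\infty[\gamma]:=\gamma\text{-}\operatorname{ess\,sup}_{X}c$ is the $\gamma$-essential supremum of $c$. Problem $(P_\infty)$ is to minimize $C_\infty[\gamma]$ over $\gamma\in\Pi(\mu^1,\dots,\mu^N)$. A set $\Gamma\subset X$ is infinitely $c$-cyclically monotone (ICM) if for every $k\ge1$, every $k$-tuple of points $(x^{1,i},\dots,x^{N,i})_{i=1}^k$ of $\Gamma$ and every $(N-1)$-tuple $(\sigma^2,\dots,\sigma^N)$ of permutations of $\{1,\dots,k\}$, $$\max_{1\le i\le k}c(x^{1,i},x^{2,i},\dots,x^{N,i})\le\max_{1\le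 i\le k}c(x^{1,i},x^{2,\sigma^2(i)},\dots,x^{N,\sigma^N(i)}).$$ A coupling $\gamma$ is ICM if it is concentrated on an ICM set. *)

(* Defs.v *)
From HB Require Import structures.
From mathcomp Require Import all_boot all_order all_algebra.
From mathcomp Require Import fingroup perm.
From mathcomp Require Import all_classical all_reals all_analysis.

Set Implicit Arguments.
Unset Strict Implicit.
Unset Printing Implicit Defensive.

Import Order.TTheory GRing.Theory Num.Theory.
Import numFieldNormedType.Exports.

Local Open Scope classical_set_scope.
Local Open Scope ring_scope.
Local Open Scope ereal_scope.

(* The measurable type of Borel sets of [T]. The library puts a generated
   sigma-algebra on pointed types only; this costs no generality, since a space
   carrying a probability measure is not empty. *)
Notation borel T := (g_sigma_algebraType (@open T)).

Definition separable (T : topologicalType) :=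
  exists2 D : set T, countable D & dense D.

(* Completeness of [M] is the axiom of the library's [completeType], which
   cannot be used directly because its elements are pointed types. *)
Definition completely_metrizable (R : realType) (T : topologicalType) :=
  exists (M : metricType R) (f : T -> M) (g : M -> T),
    [/\ cancel f g, cancel g f, continuous f, continuous g &
        forall F : set_system M, ProperFilter F -> cauchy F ->
          exists p : M, F --> p].

Definition polish (R : realType) (T : topologicalType) :=
  separable T /\ completely_metrizable R T.

Definition msupport (R : realType) (T : ptopologicalType)
    (mu : probability (borel T) R) : set T :=
  [set x | forall U : set T, open_nbhs x U -> 0 < mu U].

Definition coupling (R : realType) (N : nat) (X : 'I_N -> ptopologicalType)
    (mu : forall i, probability (borel (X i)) R)
    (gamma : probability (borel (prod_topology X)) R) :=
  forall (i : 'I_N) (A : set (borel (X i))), measurable A ->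
    pushforward gamma
      (fun x : borel (prod_topology X) => x i : borel (X i)) A = mu i A.

(* The tuple of permutations (sigma^2, ..., sigma^N) is encoded as a family [s]
   indexed by all of ['I_N] that is the identity at the first index. *)
Definition ICM_set (R : realType) (N : nat) (X : 'I_N -> Type)
    (c : (forall i, X i) -> \bar R) (G : set (forall i, X i)) :=
  forall (k : nat) (x : 'I_k -> forall i, X i) (s : 'I_N -> {perm 'I_k}),
    (0 < k)%N -> (forall j, G (x j)) ->
    (forall i : 'I_N, i = 0%N :> nat -> s i = 1%g) ->
    \big[maxe/-oo]_(j < k) c (x j) <=
    \big[maxe/-oo]_(j < k) c (fun i => x (s i j) i).

Definition ICM_plan (R : realType) (N : nat) (X : 'I_N -> ptopologicalType)
    (c : prod_topology X -> \bar R)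
    (gamma : probability (borel (prod_topology X)) R) :=
  exists2 G : set (prod_topology X), ICM_set c G & gamma.-negligible (~` G).

(* Main.v *)
Require Import Defs.
From HB Require Import structures.
From mathcomp Require Import all_boot all_order all_algebra.
From mathcomp Require Import fingroup perm finmap.
From mathcomp Require Import all_classical all_reals all_analysis.
From mathcomp Require Import ess_sup_inf.

Import Order.TTheory GRing.Theory Num.Theory.
Import numFieldNormedType.Exports.

Local Open Scope classical_set_scope.
Local Open Scope ring_scope.
Local Open Scope ereal_scope.

(** Suppose that a coupling [beta] does strictly better than the ICM coupling
    [gamma], let [b] be the essential supremum of [c] for [beta], and take [M]
    strictly between [b] and the one for [gamma]. The idea is to replace both
    couplings by finite lists of points, since for finite lists with the same
    marginals, one is obtained from the other by permuting coordinates, and this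
    is exactly what infinite cyclical monotonicity speaks of.

    The replacement rests on a finite partition. By continuity of [c], each
    point of the product of the supports, which is compact, has a neighbourhood
    on which [c < M] throughout or [c > b] throughout; finitely many open boxes
    of this kind cover it ([compact_box_cover]). Label a coordinate by the set
    of boxes in which it fits. Points with the same labels in all coordinates
    form a cell, and if a cell contains a point of the supports with cost at
    most [b], then a box around that point contains the whole cell, so that
    [c < M] on it.

    The masses that [gamma] and [beta] give to the cells solve a linear system
    with integer coefficients, which says that the label marginals agree. This
    system then also has a solution in natural numbers that charges the same
    cells ([integer_cell_masses]), that is, two lists of cells of equal length,
    related by permutations of each label ([matching_of_marginals]).

    Every cell of the [gamma] list has positive [gamma]-mass, so a point of the
    ICM set can be chosen in it, and one of them with cost above [M]. Permuting
    their coordinates gives points in the cells of the [beta] list. These have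
    positive [beta]-mass, hence contain points of the supports of cost at most
    [b] ([coupling_ae_support], [positive_meets_ae]), so all the recombined
    points cost less than [M]. This contradicts cyclical monotonicity. *)

Set Implicit Arguments.
Unset Strict Implicit.
Unset Printing Implicit Defensive.

(** * Natural solutions of integer linear systems *)

(** A kernel with rational coefficients has a rational basis, so a real kernel
    vector is a real combination of that basis; moving the real weights to
    nearby rationals stays in the kernel and keeps the positive entries
    positive. *)
Lemma positive_rational_kernel (R : realType) (m n : nat) (A : 'M[rat]_(m, n))
    (v : 'rV[R]_m) :
  v *m map_mx ratr A = 0%R ->
  exists2 u : 'rV[rat]_m, u *m A = 0%R &
    forall i, (0 < v ord0 i)%R -> (0 < u ord0 i)%R.
Proof.
move=> /sub_kermxP; rewrite -map_kermx => /submxP[w vE].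
set K := kermx A in vE.
(* Weights within [e / S] of those of [v] change each entry by less than [e],
   the least positive entry of [v]. *)
pose S : R := (1 + \sum_k \sum_i `|ratr (K k i)|)%R.
pose e : R := (\big[Num.min/1]_(i < m | 0 < v ord0 i) v ord0 i)%R.
have e0 : (0 < e)%R.
  by rewrite /e; elim/big_ind : _ => // x y x0 y0; rewrite lt_min x0.
have S0 : (0 < S)%R.
  by rewrite ltr_pwDl// sumr_ge0// => k _; rewrite sumr_ge0.
have ex k : exists q : rat, (`|w ord0 k - ratr q| < e / S)%R.
  have lt_w : (w ord0 k < w ord0 k + e / S)%R by rewrite ltrDl divr_gt0.
  have [q /itvP qP] := rat_in_itvoo lt_w.
  exists q; rewrite ltr_distlC; rewrite qP andbT.
  by rewrite (lt_trans _ (_ : w ord0 k < _)%R) ?qP// gtrBl divr_gt0.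
pose q k := sval (cid (ex k)).
have qP k : (`|w ord0 k - ratr (q k)| < e / S)%R := svalP (cid (ex k)).
exists ((\row_k q k) *m K).
  by rewrite -mulmxA mulmx_ker mulmx0.
move=> i vi0; rewrite -(ltr0q R).
have ev : (e <= v ord0 i)%R by rewrite /e; apply: bigmin_le_cond.
apply/(lt_le_trans _ (_ : v ord0 i - e / S * \sum_k `|ratr (K k i)| <= _)%R).
  rewrite subr_gt0 (lt_le_trans _ ev)// -mulrA gtr_pMr// ltr_pdivrMl ?mulr1//.
  rewrite /S (le_lt_trans _ (_ : \sum_k \sum_i `|ratr (K k i)| < _)%R) ?ltrDr//.
  apply: ler_sum => k _; rewrite [leRHS](bigD1 i)//= lerDl.
  by apply: sumr_ge0.
rewrite lerBlDr -lerBlDl mulr_sumr.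
have -> : (v ord0 i - ratr (((\row_k q k) *m K) ord0 i) =
    \sum_k (w ord0 k - ratr (q k)) * ratr (K k i))%R.
  rewrite vE !mxE rmorph_sum/= -sumrB; apply: eq_bigr => k _.
  by rewrite !mxE rmorphM/= mulrBl.
apply: (le_trans (ler_norm _)); apply: (le_trans (ler_norm_sum _ _ _)).
by apply: ler_sum => k _; rewrite normrM ler_wpM2r// ltW.
Qed.

(** This is what lets two real mass distributions with the same marginals be
    replaced by two lists of points with the same marginals: only which cells
    are charged matters, and multiplicities must be whole numbers. *)
Lemma natural_solution (R : realType) (I J : finType) (A : J -> I -> int)
    (v : I -> R) :
  (forall i, 0 <= v i)%R -> (forall j, \sum_i (A j i)%:~R * v i = 0)%R ->
  exists2 u : I -> nat, forall j, (\sum_i A j i * (u i)%:Z = 0)%R &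
    forall i, (0 < u i)%N = (0 < v i)%R.
Proof.
move=> v0 Av.
(* The extra columns indexed by [I] force a solution to vanish where [v] does;
   otherwise approximation could turn a zero entry into a negative one. *)
pose a (i : I) (k : J + I) : rat := match k with
  | inl j => (A j i)%:~R | inr i' => ((i == i') && (v i == 0%R))%:R end.
pose M := (\matrix_(r < #|I|, s < #|{: J + I}|) a (enum_val r) (enum_val s))%R.
pose V := (\row_(r < #|I|) v (enum_val r))%R.
have VM : (V *m map_mx ratr M = 0)%R.
  apply/rowP => s; rewrite !mxE.
  under eq_bigr do rewrite !mxE.
  rewrite -(big_enum_val (A := I) (fun i => v i * ratr (a i (enum_val s))))%R/=.
  case: (enum_val s) => [j|i'] /=.
    by rewrite -[RHS](Av j); apply: eq_bigr => i _; rewrite ratr_int mulrC.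
  rewrite big1// => i _; case: eqP => /= [_|_]; last by rewrite ratr_nat mulr0.
  by case: eqP => [->|_]; rewrite ?mul0r// ratr_nat mulr0.
have [U UM U0] := positive_rational_kernel VM.
pose q i := U ord0 (enum_rank i).
have qA k : (\sum_i q i * a i k = 0)%R.
  have /rowP/(_ (enum_rank k)) := UM; rewrite !mxE.
  under eq_bigr do rewrite !mxE.
  move=> Uk; transitivity (\sum_(i in I) q i * a i k)%R; first exact: eq_bigl.
  rewrite -[RHS]Uk big_enum_val; apply: eq_bigr => r _.
  by rewrite /q enum_valK enum_rankK.
have q_eq0 i : v i = 0%R -> q i = 0%R.
  move=> vi0; rewrite -[RHS](qA (inr i)) (bigD1 i)//= eqxx vi0 eqxx mulr1.
  by rewrite big1 ?addr0// => i' /negbTE ->; rewrite mulr0.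
have q_gt0 i : (0 < v i)%R -> (0 < q i)%R.
  by move=> vi; apply: U0; rewrite mxE enum_rankK.
have q_ge0 i : (0 <= q i)%R.
  have := v0 i; rewrite le_eqVlt => /predU1P[/esym/q_eq0->//|/q_gt0].
  exact: ltW.
have q0 i : (0 < q i)%R = (0 < v i)%R.
  apply/idP/idP => [|/q_gt0//]; apply: contraTT; rewrite -leNgt => vi.
  by rewrite q_eq0 ?ltxx//; apply/le_anti; rewrite vi v0.
(* Multiplying by a common denominator keeps the kernel and the signs. *)
pose D : int := (\prod_i denq (q i))%R.
have D0 : (0 < D)%R by apply: prodr_gt0.
pose u i := `|(numq (q i) * \prod_(i' | i' != i) denq (q i'))%R|%N.
have uE i : ((u i)%:R = q i * D%:~R :> rat)%R.
  rewrite /u -[_%:R]/((_%:Z)%:~R)%R gez0_abs; last first.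
    by rewrite mulr_ge0 ?numq_ge0 ?prodr_ge0.
  have -> : D = (denq (q i) * \prod_(i' | i' != i) denq (q i'))%R.
    by rewrite /D (bigD1 i).
  by rewrite !intrM mulrA -{2}(divq_num_den (q i)) divfK// intr_eq0 denq_eq0.
exists u => [j|i].
  apply: (@intr_inj rat); rewrite rmorph_sum/=.
  transitivity (\sum_i q i * a i (inl j) * D%:~R)%R.
    apply: eq_bigr => i _.
    by rewrite rmorphM/= mulrC -[(_%:Z)%:~R]/(_%:R) uE mulrAC.
  by rewrite -mulr_suml qA mul0r.
by rewrite -(ltr0n rat) uE pmulr_lgt0 ?ltr0z// q0.
Qed.

(** Let [x] list each [q] with multiplicity [g q] and [y] with multiplicity
    [b q]. Equal marginals say that the [i]-th labels of [x] and of [y] are the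
    same multiset, hence a permutation [s i] relates them. Reordering [x] by the
    permutation of the index [i0] makes [s i0] the identity. *)
Lemma matching_of_marginals (I Q L : finType) (lab : I -> Q -> L)
    (g b : Q -> nat) (i0 : I) :
  (forall i l, \sum_(q | lab i q == l) g q = \sum_(q | lab i q == l) b q)%N ->
  exists (k : nat) (x y : 'I_k -> Q) (s : I -> {perm 'I_k}),
    [/\ forall j, (0 < g (x j))%N, forall j, (0 < b (y j))%N,
        forall q, (0 < g q)%N -> exists j, x j = q, s i0 = 1%g &
        forall i j, lab i (y j) = lab i (x (s i j))].
Proof.
move=> gb.
pose lst (h : Q -> nat) := flatten [seq nseq (h q) q | q <- enum Q].
have lstE h a : count a (lst h) = (\sum_(q | a q) h q)%N.
  rewrite /lst count_flatten -map_comp sumnE big_map big_enum/=.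
  rewrite [RHS]big_mkcond/=; apply: eq_bigr => q _.
  by rewrite count_nseq; case: (a q); rewrite ?mul1n ?mul0n.
have lst_gt0 h q : (q \in lst h) = (0 < h q)%N.
  by rewrite -has_pred1 has_count lstE big_pred1_eq.
have szE : size (lst b) == size (lst g).
  rewrite -!(count_predT (lst _)) !lstE !(partition_big (lab i0) xpredT)//=.
  by apply/eqP/eq_bigr => l _; rewrite gb.
pose k := size (lst g); pose xt := in_tuple (lst g).
pose yt : k.-tuple Q := Tuple szE.
have st i : exists s : {perm 'I_k},
    forall j, lab i (tnth yt j) = lab i (tnth xt (s j)).
  have /tuple_permP[s sE] : perm_eq (map_tuple (lab i) yt) (map_tuple (lab i) xt).
    apply/seq.permP => a; rewrite /= !count_map !lstE.
    have countE h : (\sum_(q | a (lab i q)) h q =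
        \sum_(l | a l) \sum_(q | lab i q == l) h q)%N.
      rewrite (partition_big (lab i) a)//=; apply: eq_bigr => l al.
      by apply: eq_bigl => q; case: eqP => [->|]; rewrite ?al ?andbF.
    by rewrite !countE; apply: eq_bigr => l _; rewrite gb.
  exists s => j; have : map_tuple (lab i) yt =
    [tuple tnth (map_tuple (lab i) xt) (s j') | j' < k] by exact/val_inj.
  by move/(congr1 (fun t => tnth t j)); rewrite tnth_mktuple !tnth_map.
pose s i := sval (cid (st i)).
have sP i j : lab i (tnth yt j) = lab i (tnth xt (s i j)) := svalP (cid (st i)) j.
exists k, (fun j => tnth xt (s i0 j)), (tnth yt), (fun i => s i * (s i0)^-1)%g.
split.
- by move=> j; rewrite -lst_gt0 mem_tnth.
- by move=> j; rewrite -lst_gt0 mem_tnth.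
- move=> q; rewrite -lst_gt0 => /(tnthP xt)[j ->].
  by exists ((s i0)^-1%g j); rewrite permKV.
- by rewrite mulgV.
- by move=> i j; rewrite permM permKV sP.
Qed.

(** * Supports and compact sets in finite products *)

(** The balls of radius [1 / n.+1] around a countable dense set that are
    negligible cover the complement of the support: a point off the support has
    a null neighbourhood, which contains such a ball around a dense point close
    to it. *)
Lemma msupport_negligible (R : realType) (T : ptopologicalType)
    (mu : probability (borel T) R) :
  separable T -> completely_metrizable R T -> mu.-negligible (~` msupport mu).
Proof.
move=> [D cD dD] [M [f [g [fK gK fc gc _]]]].
pose B (d : T) (n : nat) : set T := f @^-1` ball (f d) n.+1%:R^-1.
have [d0 [_ Dd0]] : [set: T] `&` D !=set0 by apply: dD; [exists point|exact: openT].
have [h hD] : exists h : nat -> T, D `<=` range h.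
  have /pcard_geP[F] : (D #<= [set: nat])%card by [].
  exists F => x /(surj (f := F))[k _ <-]; by exists k.
pose C (k : nat * nat) := B (h k.1) k.2.
pose E k := if `[< mu.-negligible (C k) >] then C k else set0.
have nE k : mu.-negligible (E k).
  by rewrite /E; case: asboolP => // _; exact: negligible_set0.
apply: (@negligibleS _ (borel T) R mu (\bigcup_i \bigcup_j E (i, j))); last first.
  by apply: negligible_bigcup => i; exact: negligible_bigcup.
move=> x /= /existsNP[U /not_implyP[[oU Ux] /negP]].
rewrite -leNgt measure_le0 => /eqP muU.
have nU : nbhs (f x) (g @^-1` U).
  apply: gc; rewrite fK; exact: open_nbhs_nbhs.
move/nbhs_ballP: nU => [e /= e0 eU].
have [n ne] : exists n : nat, (n.+1%:R^-1 < e / 2 :> R)%R.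
  have [n _ /(_ _ (leqnn n))] :=
    near_infty_natSinv_lt (PosNum (divr_gt0 e0 (ltr0Sn R 1))).
  by exists n.
have nB : nbhs x (f @^-1` ball (f x) n.+1%:R^-1).
  apply: fc; apply: nbhsx_ballx; by rewrite invr_gt0.
have [d [dx Dd]] : (f @^-1` ball (f x) n.+1%:R^-1)^° `&` D !=set0.
  by apply: dD; [exists x|exact: open_interior].
move/interior_subset : dx => dx.
have [k _ kd] := hD _ Dd.
exists k => //; exists n => //; rewrite /E; case: asboolP => [_|[]].
  by rewrite /C /B/= kd; apply: ball_sym.
exists U; split=> //; first exact: sub_sigma_algebra.
move=> y; rewrite /C /B /= kd => dy.
rewrite -(fK y); apply: eU.
(* [d] is within [e / 2] of both [x] and [y]. *)
rewrite (splitr e); apply: (ball_triangle (y := f d)).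
  exact: (le_ball (ltW ne)).
exact: (le_ball (ltW ne)).
Qed.

(** The sets that contain an open box around [x] form a filter; since [N] is
    finite, it is enough to check its convergence to [x] along each coordinate,
    where the box constrains that coordinate only. *)
Lemma prod_topology_box_nbhs (N : nat) (X : 'I_N -> ptopologicalType)
    (x : prod_topology X) (U : set (prod_topology X)) :
  nbhs x U -> exists V : forall i, set (X i),
    (forall i, open_nbhs (x i) (V i)) /\
    [set y | forall i, V i (y i)] `<=` U.
Proof.
pose F : set_system (prod_topology X) := fun U => exists V : forall i, set (X i),
    (forall i, open_nbhs (x i) (V i)) /\
    [set y | forall i, V i (y i)] `<=` U.
have FF : Filter F.
  split.
  - by exists (fun i => setT); split=> // i; split => //; exact: openT.
  - move=> P Q [V [Vx VP]] [W [Wx WQ]]; exists (fun i => V i `&` W i); split.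
      by move=> i; have [? ?] := Vx i; have [? ?] := Wx i; split; [exact: openI|].
    by move=> y VWy; split; [apply: VP => i|apply: WQ => i]; have [] := VWy i.
  - by move=> P Q PQ [V [Vx VP]]; exists V; split=> //; exact: subset_trans PQ.
suff : F --> x by apply.
apply/cvg_sup => i A [B [[W oW <-] Wx] BA].
exists (@dfwith _ (fun j => set (X j)) (fun=> setT) i W); split.
  by move=> j; case: dfwithP => // j' _; split => //; exact: openT.
move=> y Wy; apply: BA; have := Wy i; by rewrite dfwithin.
Qed.

(** Tychonoff together with a cover by boxes. Boxes, unlike general open sets,
    are determined by one condition on each coordinate, which is what makes
    membership survive when coordinates are recombined. *)
Lemma compact_box_cover (N : nat) (X : 'I_N -> ptopologicalType)
    (K : forall i, set (X i)) (P : set (set (prod_topology X))) :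
  (forall i, compact (K i)) ->
  (forall U V, U `<=` V -> P V -> P U) ->
  (forall x : prod_topology X, (forall i, K i (x i)) ->
    exists2 U, nbhs x U & P U) ->
  exists (T : finType) (V : T -> forall i, set (X i)),
    [/\ forall t i, open (V t i), forall t, P [set x | forall i, V t i (x i)] &
        forall x, (forall i, K i (x i)) -> exists t, forall i, V t i (x i)].
Proof.
move=> Kc PS PK; have Kcomp := tychonoff Kc.
(* [Y] carries the base point along with the topology, as the cover form of
   compactness asks. *)
pose Y : ptopologicalType := HB.pack_for ptopologicalType (prod_topology X)
  (Topological.on (prod_topology X)) (Pointed.on (prod_topology X)).
have : @compact Y [set f | forall i, K i (f i)] by exact: Kcomp.
rewrite compact_cover.
pose I := {classic forall i, set (X i)}.
pose sides (V : I) : forall i, set (X i) := V.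
pose box (V : I) : set Y := [set x : prod_topology X | forall i, sides V i (x i)].
pose D : set I := [set V | (forall i, open (sides V i)) /\ P (box V)].
move=> /(_ I D box)[].
- move=> V [oV _].
  rewrite openE => x Vx; rewrite /interior.
  apply: (@filter_forall (prod_topology X) 'I_N (fun i y => sides V i (y i))
    (nbhs (x : prod_topology X))) => i.
  by apply: (@proj_continuous _ X i x); apply: open_nbhs_nbhs; split.
- move=> x /PK[U xU PU].
  have [V [oV VU]] := prod_topology_box_nbhs xU.
  exists V; last by move=> i; have [] := oV i.
  by split; [move=> i; have [] := oV i|exact: PS PU].
- move=> E ED KE; exists (E : finType), (fun t => sides (val t)); split.
  + by move=> t i; have /set_mem[] := ED _ (valP t).
  + by move=> t; have /set_mem[] := ED _ (valP t).
  + by move=> x /KE[V /= VE Vx]; exists (FSetSub VE).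
Qed.

(** * Cells of a finite labelling *)

Lemma measure_finite_union d (T : measurableType d) (R : realType)
    (P : probability T R) (Q : finType) (A : Q -> set T) (a : pred Q) :
  (forall q, measurable (A q)) -> trivIset [set: Q] A ->
  P [set x | exists2 q, a q & A q x] = \sum_(q | a q) P (A q).
Proof.
move=> mA tA; rewrite -big_filter.
rewrite fsbig_seq ?filter_uniq ?index_enum_uniq//.
rewrite -measure_fin_bigcup//; last exact: sub_trivIset tA.
congr (P _); apply/seteqP; split=> x.
  by case=> q aq Aq; exists q => //=; rewrite mem_filter aq mem_index_enum.
by case=> q /=; rewrite mem_filter => /andP[aq _] Aq; exists q.
Qed.

Lemma measurable_joint_fiber d (T : measurableType d) (I L : finType)
    (lab : I -> T -> L) (q : {ffun I -> L}) :
  (forall i l, measurable [set x | lab i x = l]) ->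
  measurable [set x | [ffun i => lab i x] = q].
Proof.
move=> mlab.
rewrite (_ : [set _ | _] = \bigcap_(i in [set: I]) [set x | lab i x = q i]).
  exact: fin_bigcap_measurable.
apply/seteqP; split => x /= xq; first by move=> i _; rewrite -xq ffunE.
by apply/ffunP => i; rewrite ffunE; exact: xq.
Qed.

(** The cell masses of [P] and [P'] are a nonnegative solution of the linear
    equations, with coefficients 1 and -1, that say that the two families of
    marginals agree; [natural_solution] gives the counts. *)
Lemma integer_cell_masses d (T : measurableType d) (R : realType)
    (P P' : probability T R) (I L : finType) (lab : I -> T -> L) :
  (forall i l, measurable [set x | lab i x = l]) ->
  (forall i l, P [set x | lab i x = l] = P' [set x | lab i x = l]) ->
  exists n n' : {ffun I -> L} -> nat,
    [/\ forall i l,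
          (\sum_(q : {ffun I -> L} | q i == l) n q =
           \sum_(q : {ffun I -> L} | q i == l) n' q)%N,
        forall q, (0 < n q)%N = (0 < P [set x | [ffun i => lab i x] = q]) &
        forall q, (0 < n' q)%N = (0 < P' [set x | [ffun i => lab i x] = q])].
Proof.
move=> mlab PP'.
pose cell (q : {ffun I -> L}) := [set x | [ffun i => lab i x] = q].
have mcell q : measurable (cell q) by exact: measurable_joint_fiber.
have tcell : trivIset [set: {ffun I -> L}] cell.
  by move=> q q' _ _ [x [<- <-]].
have fiberE (mu : probability T R) i l : mu [set x | lab i x = l] =
    \sum_(q : {ffun I -> L} | q i == l) mu (cell q).
  rewrite -(@measure_finite_union _ _ _ _ _ _ (fun q : {ffun I -> L} => q i == l))//.
  congr (mu _); apply/seteqP; split => [x xl|x].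
    by exists [ffun i' => lab i' x]; rewrite ?ffunE//; apply/eqP.
  by case=> q /eqP <- <-; rewrite /= ffunE.
pose Q : finType := {ffun I -> L}.
pose A (k : I * L) (z : Q + Q) : int := match z with
  | inl q => (q k.1 == k.2)%:R | inr q => - (q k.1 == k.2)%:R end%R.
pose v (z : Q + Q) : R := match z with
  | inl q => fine (P (cell q)) | inr q => fine (P' (cell q)) end.
have sumE (mu : probability T R) i l :
    (\sum_(q : {ffun I -> L}) (q i == l)%:R * fine (mu (cell q)))%R
    = fine (mu [set x | lab i x = l]).
  rewrite fiberE -sum_fine => [|q _]; last exact: fin_num_measure.
  rewrite [RHS]big_mkcond/=; apply: eq_bigr => q _.
  by case: (q i == l); rewrite ?mul1r ?mul0r.
have Av k : (\sum_z (A k z)%:~R * v z = 0)%R.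
  rewrite big_sumType/=; under [X in (_ + X)%R]eq_bigr do rewrite rmorphN/= mulNr.
  rewrite sumrN; apply/eqP; rewrite subr_eq0; apply/eqP.
  transitivity (fine (P [set x | lab k.1 x = k.2])).
    by rewrite -sumE; apply: eq_bigr => q _; case: eqP.
  by rewrite PP' -sumE; apply: eq_bigr => q _; case: eqP.
have v0 z : (0 <= v z)%R by case: z => q; exact: fine_ge0.
have v_gt0 (mu : probability T R) q : (0 < fine (mu (cell q)))%R = (0 < mu (cell q)).
  by rewrite -lte_fin fineK// fin_num_measure.
have [u Au u0] := natural_solution v0 Av.
exists (u \o inl), (u \o inr); split => [i l|q|q]; last 2 first.
- by rewrite /= u0 v_gt0.
- by rewrite /= u0 v_gt0.
have sumNE (f : Q -> nat) :
    ((\sum_(q : Q | q i == l) f q)%N%:Z = \sum_(q : Q) (q i == l)%:R * (f q)%:Z)%R.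
  rewrite -[LHS]intz sumMz big_mkcond/=; apply: eq_bigr => q _.
  by case: (q i == l); rewrite ?mul1r ?mul0r ?intz.
have := Au (i, l); rewrite big_sumType/=.
under [X in (_ + X)%R]eq_bigr do rewrite mulNr.
move/eqP; rewrite sumrN subr_eq0 -!sumNE => /eqP[]//.
Qed.

(** * Almost sure properties *)

Lemma exists_ereal_between (R : realType) (x y : \bar R) :
  x < y -> exists z, x < z < y.
Proof.
case: x y => [x| |] [y| |]//.
- rewrite lte_fin => xy; exists ((x + y) / 2)%:E.
  by rewrite !lte_fin !midf_lt.
- by move=> _; exists (x + 1)%:E; rewrite lte_fin ltrDl ltr01 ltry.
- by move=> _; exists (y - 1)%:E; rewrite lte_fin gtrBl ltr01 ltNyr.
- by move=> _; exists 0; rewrite ltNyr ltry.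
Qed.

Lemma ae_conj d (T : measurableType d) (R : realType) (P : probability T R)
    (A B : set T) :
  (\forall x \ae P, A x) -> (\forall x \ae P, B x) ->
  \forall x \ae P, A x /\ B x.
Proof. exact: filterI. Qed.

Lemma lt_ess_sup_exists d (T : measurableType d) (R : realType)
    (P : probability T R) (f : T -> \bar R) (M : \bar R) (A : set T) :
  M < ess_sup P f -> (\forall x \ae P, A x) -> exists2 x, A x & M < f x.
Proof.
rewrite ltNge => /negP Mf Aae; apply: contrapT => AM; apply: Mf; apply/ess_supP.
apply: filterS Aae => x Ax; rewrite leNgt; apply/negP => Mx.
by apply: AM; exists x.
Qed.

Lemma positive_meets_ae d (T : measurableType d) (R : realType)
    (P : probability T R) (A B : set T) :
  measurable A -> 0 < P A -> (\forall x \ae P, B x) -> exists2 x, A x & B x.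
Proof.
move=> mA PA Bae; apply: contrapT => AB.
suff : P.-negligible A by move/(negligibleP _ mA) => P0; rewrite P0 ltxx in PA.
apply: negligibleS Bae => x Ax /= Bx; apply: AB; by exists x.
Qed.

(** The fibers of measure zero are finitely many, so almost no point lies in
    one of them. *)
Lemma ae_positive_fiber d (T : measurableType d) (R : realType)
    (P : probability T R) (Q : finType) (f : T -> Q) :
  (forall q, measurable [set x | f x = q]) ->
  \forall x \ae P, 0 < P [set y | f y = f x].
Proof.
move=> mf.
have : \forall x \ae P, forall q, f x = q -> 0 < P [set y | f y = q].
  apply: filter_forall => q.
  have [Pq|] := ltP 0 (P [set y | f y = q]); first exact: nearW.
  rewrite measure_le0 => /eqP Pq; exists [set y | f y = q]; split=> // x /=.
  by move/not_implyP => [].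
by apply: filterS => x; exact.
Qed.

Lemma measurable_coord_preimage (N : nat) (X : 'I_N -> ptopologicalType)
    (i : 'I_N) (A : set (borel (X i))) :
  measurable A ->
  measurable ((fun x : borel (prod_topology X) => x i : borel (X i)) @^-1` A).
Proof.
move=> mA.
have mf : measurable_fun setT (fun x : borel (prod_topology X) => x i : borel (X i)).
  apply: (measurability (@open (X i) : set (set (borel (X i))))) => // _ [B oB <-].
  rewrite setTI; apply: sub_sigma_algebra.
  apply: open_comp => // x _; exact: (@proj_continuous _ X i x).
by rewrite -[X in measurable X]setTI; exact: mf.
Qed.

Lemma coupling_ae_support (R : realType) (N : nat) (X : 'I_N -> ptopologicalType)
    (mu : forall i, probability (borel (X i)) R)
    (beta : probability (borel (prod_topology X)) R) :
  (forall i, polish R (X i)) -> coupling mu beta ->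
  \forall x \ae beta, forall i, msupport (mu i) (x i).
Proof.
move=> hX cpl; apply: filter_forall => i.
have [sX cX] := hX i.
have [B [mB B0 suppB]] := msupport_negligible (mu i) sX cX.
exists ((fun x : borel (prod_topology X) => x i : borel (X i)) @^-1` B); split.
- exact: measurable_coord_preimage.
- by rewrite -[LHS](cpl i B mB) in B0.
- by move=> x /= ?; exact: suppB.
Qed.

(** * Optimality of ICM couplings *)

Theorem theorem1p3 (R : realType) (N : nat) (hN : (2 <= N)%N)
  (X : 'I_N -> ptopologicalType) (hX : forall i, polish R (X i))
  (mu : forall i, probability (borel (X i)) R)
  (hmu : forall i, compact (msupport (mu i)))
  (c : prod_topology X -> \bar R)
  (c_ninfty : forall x, c x != -oo) (c_cont : continuous c)
  (gamma : probability (borel (prod_topology X)) R)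
  (gamma_cpl : coupling mu gamma) (gamma_icm : ICM_plan c gamma) :
  forall beta : probability (borel (prod_topology X)) R,
    coupling mu beta -> ess_sup gamma c <= ess_sup beta c.
Proof.
move=> beta beta_cpl; rewrite leNgt; apply/negP.
move=> /exists_ereal_between[M /andP[bM Mg]]; set b := ess_sup beta c in bM.
have [G Gicm Gnull] := gamma_icm.
have Gae : \forall x \ae gamma, G x by exact: Gnull.
pose low_or_high (U : set (prod_topology X)) :=
  (forall x, U x -> c x < M) \/ (forall x, U x -> b < c x).
have [|x _|T [V [oV VP KV]]] := @compact_box_cover N X _ low_or_high hmu.
- by move=> U W UW [WP|WP]; [left|right] => x /UW; exact: WP.
- have [cM|Mc] := ltP (c x) M.
    exists [set y | c y < M]; last by left.
    apply: open_nbhs_nbhs; split => //.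
    apply: (@open_comp _ _ c [set z | z < M]) => [y _|]; first exact: c_cont.
    exact: open_ereal_lt_ereal.
  exists [set y | b < c y]; last by right.
  apply: open_nbhs_nbhs; split; last exact: lt_le_trans Mc.
  apply: (@open_comp _ _ c [set z | b < z]) => [y _|]; first exact: c_cont.
  exact: open_ereal_gt_ereal.
(* The label of a coordinate records in which boxes that coordinate fits, so
   points with equal labels lie in the same boxes. *)
pose lab i (x : X i) : {set T} := [set t | `[< V t i x >]]%SET.
have mlab i l : measurable [set x : borel (X i) | lab i x = l].
  rewrite (_ : [set _ | _] =
    \bigcap_(t in [set: T]) if t \in l then V t i else ~` V t i).
    apply: fin_bigcap_measurable => // t _.
    have mV : measurable (V t i : set (borel (X i))) by exact: sub_sigma_algebra.
    by case: ifP => _ //; exact: measurableC.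
  apply/seteqP; split => x /=.
    by move=> <- t _; rewrite inE; case: asboolP.
  move=> xl; apply/setP => t; rewrite inE; have := xl t I.
  by case: (t \in l) => Vx; [exact/asboolP|exact/asboolPn].
pose labX i (x : borel (prod_topology X)) := lab i (x i).
have mlabX i l : measurable [set x | labX i x = l].
  exact: (measurable_coord_preimage (mlab i l)).
have [n [n' [nn' n_gt0 n'_gt0]]] :
    exists n n' : {ffun 'I_N -> {set T}} -> nat,
    [/\ forall i l, (\sum_(q : {ffun 'I_N -> {set T}} | q i == l) n q =
           \sum_(q : {ffun 'I_N -> {set T}} | q i == l) n' q)%N,
        forall q, (0 < n q)%N = (0 < gamma [set x | [ffun i => labX i x] = q]) &
        forall q, (0 < n' q)%N = (0 < beta [set x | [ffun i => labX i x] = q])].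
  apply: integer_cell_masses mlabX _ => i l.
  transitivity (mu i [set x | lab i x = l]); last exact/esym/beta_cpl.
  exact: gamma_cpl.
pose ell (x : borel (prod_topology X)) : {ffun 'I_N -> {set T}} :=
  [ffun i => labX i x].
have mell q : measurable [set x | ell x = q].
  exact: measurable_joint_fiber mlabX.
(* The cell of [z] is charged by [gamma], so it occurs in the list of cells; its
   chosen point then brings the maximal cost of the list above [M]. *)
have [z [Gz ellz Mz]] : exists z, [/\ G z, (0 < n (ell z))%N & M < c z].
  have [z [Gz ellz] Mz] :=
    lt_ess_sup_exists Mg (ae_conj Gae (ae_positive_fiber gamma mell)).
  by exists z; split=> //; rewrite n_gt0.
have /choice[pt ptP] : forall q, exists x, (0 < n q)%N ->
    [/\ G x, ell x = q & q = ell z -> M < c x].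
  move=> q; have [->|qz] := eqVneq q (ell z); first by exists z.
  have [nq|] := boolP (0 < n q)%N; last by exists z.
  have := nq; rewrite n_gt0 => gq.
  have [x xq Gx] := positive_meets_ae (mell q) gq Gae.
  by exists x => _; split=> // /eqP; rewrite (negbTE qz).
pose i0 : 'I_N := Ordinal (ltnW hN).
have [k [x [y [s [nx n'y xz s0 yx]]]]] :=
  @matching_of_marginals 'I_N {ffun 'I_N -> {set T}} {set T}
    (fun i q => q i) n n' i0 nn'.
have [jz xjz] := xz _ ellz.
have k_gt0 : (0 < k)%N by exact: leq_ltn_trans (ltn_ord jz).
have GX j : G (pt (x j)) by have [] := ptP _ (nx j).
have icm := Gicm k (pt \o x) s k_gt0 GX.
suff : M < M by rewrite ltxx.
apply: (@lt_trans _ _ (\big[maxe/-oo]_(j < k) c (pt (x j)))).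
  apply: (lt_le_trans _ (le_bigmax _ _ jz)).
  by have [_ _] := ptP _ (nx jz); apply.
apply: (le_lt_trans (icm _)) => [i i_eq0|].
  have -> : i = i0 by apply: val_inj.
  exact: s0.
apply/bigmax_ltP; split => [|j _]; first exact: le_lt_trans (leNye b) bM.
(* The recombined point has the labels of the cell [y j], hence shares a box
   with a point [w] of the support of cost at most [b]; that box is low. *)
have : 0 < beta [set x | ell x = y j] by rewrite -n'_gt0.
move=> /(positive_meets_ae (mell (y j))).
have ae_beta : \forall x \ae beta, (forall i, msupport (mu i) (x i)) /\ c x <= b.
  exact: ae_conj (coupling_ae_support hX beta_cpl) (ess_sup_ge beta c).
move=> /(_ _ ae_beta)[w wy [wK wb]].
have [t Vw] := KV w wK.
have Vx i : V t i (pt (x (s i j)) i).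
  have [_ ex _] := ptP _ (nx (s i j)).
  have /setP/(_ t) : lab i (pt (x (s i j)) i) = lab i (w i).
    transitivity (ell (pt (x (s i j))) i); first by rewrite ffunE.
    by rewrite ex -yx -wy ffunE.
  by rewrite !inE (asboolT (Vw i)) => /asboolP.
have [VM|Vb] := VP t; first exact: VM.
by have := le_lt_trans wb (Vb w Vw); rewrite ltxx.
Qed.
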